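(* Let $n\geq 3$ and $2\leq k\leq n-1$. The number of permutations $\pi\in\mathcal{S}_n$ such that $\pi^2$ has exactly one descent and that descent has size $k$ equals $(n-k)\,b_k\,e_{n-k-1}$.
   Context: $\mathcal{S}_n$ is the symmetric group on $[n]$; a permutation $\sigma=\sigma_1\cdots\sigma_n$ (one-line notation) has a descent at position $i\in[n-1]$ if $\sigma_i>\sigma_{i+1}$, and the size of this descent is $\sigma_i-\sigma_{i+1}$. $\pi^2(j)=\pi(\pi(j))$. $e_j$ is the number of involutions (permutations $\tau$ with $\tau^2=\mathrm{id}$) in $\mathcal{S}_j$, with $e_0=1$. For $k\geq 1$, $\mathcal{A}_k\subset\mathcal{S}_{k+1}$ is the set of permutations with exactly one descent whose size is $k$ (equivalently, $k+1$ is immediately followed by $1$ and there are no other descents), $\mathcal{B}_k=\{\beta\in\mathcal{S}_{k+1}:\beta^2\in\mathcal{A}_k\}$, and $b_k=|\mathcal{B}_k|$. *)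

(* Defs.v *)
(* Mathematical Components *)
From mathcomp Require Import all_boot all_fingroup.

Set Implicit Arguments.
Unset Strict Implicit.
Unset Printing Implicit Defensive.

Local Open Scope group_scope.

(* 'I_n is {0, ..., n-1}: positions and values are those of one-line notation
   on [n] shifted down by 1, so descents and their sizes are unaffected.
   ordS is the cyclic successor; the guard i.+1 < n excludes the wrap-around,
   and makes ordS i the position i + 1. *)
Definition descents (n : nat) (s : 'S_n) : {set 'I_n} :=
  [set i : 'I_n | (i.+1 < n)%N && (s (ordS i) < s i)%N].

(* Meaningful when i \in descents s, where the subtraction on nat is exact. *)
Definition descent_size (n : nat) (s : 'S_n) (i : 'I_n) : nat :=
  (s i - s (ordS i))%N.

Definition unique_descent_of_size (n k : nat) (s : 'S_n) : bool :=
  [exists i : 'I_n, (descents s == [set i]) && (descent_size s i == k)].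

Definition calA (k : nat) : {set 'S_k.+1} :=
  [set s : 'S_k.+1 | unique_descent_of_size k s].

Definition calB (k : nat) : {set 'S_k.+1} :=
  [set beta : 'S_k.+1 | beta ^+ 2 \in calA k].

Definition b_ (k : nat) : nat := #|calB k|.

(* The identity counts as an involution. *)
Definition e_ (j : nat) : nat := #|[set tau : 'S_j | tau ^+ 2 == 1]|.

(* Main.v *)
(* Let sigma = pi^2 have its only descent M > m, with M - m = k.  Values below m
   can only occur in the first increasing run and values above M only in the
   second, so sigma fixes every point outside the window [m, M] and acts on the
   window as an element of calA k.  Such an element has no fixed point, hence
   the window is exactly the set of points moved by sigma, and pi, which
   commutes with sigma, preserves it.  Thus pi amounts to a choice of one of
   the n - k windows, a square root of an element of calA k on the window, and
   an involution on the remaining n - k - 1 points. *)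
Require Import Defs.
From mathcomp Require Import all_boot all_fingroup.
From mathcomp Require Import zify.

Set Implicit Arguments.
Unset Strict Implicit.
Unset Printing Implicit Defensive.

(** * Permutations of a disjoint union, transported along a bijection *)

Section SumPerm.

Variables (A B T : finType) (phi : A + B -> T).
Hypothesis phi_bij : bijective phi.

Lemma sum_perm_fun_inj (b : {perm A}) (t : {perm B}) :
  injective (fun u : A + B => match u with inl x => inl (b x) | inr y => inr (t y) end).
Proof. by move=> [x|y] [x'|y'] //= [] /perm_inj ->. Qed.

(** [bijective] lives in [Prop], so the inverse of [phi] is available only inside a proof. The
    boolean characterisation lets [xchoose] turn existence into the function [sum_perm]. *)
Lemma ex_sum_perm (b : {perm A}) (t : {perm B}) :
  exists p : {perm T},
    [forall x, p (phi (inl x)) == phi (inl (b x))]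
    && [forall y, p (phi (inr y)) == phi (inr (t y))].
Proof.
have [psi phiK psiK] := phi_bij.
pose f (u : A + B) := match u with inl x => inl (b x) | inr y => inr (t y) end.
have f_inj : injective (phi \o f \o psi).
  apply: inj_comp (can_inj psiK); apply: inj_comp (can_inj phiK) _.
  exact: sum_perm_fun_inj.
exists (perm f_inj); apply/andP.
by split; apply/forallP => x; rewrite permE /= phiK.
Qed.

Definition sum_perm (b : {perm A}) (t : {perm B}) : {perm T} := xchoose (ex_sum_perm b t).

Lemma sum_perml b t x : sum_perm b t (phi (inl x)) = phi (inl (b x)).
Proof. by have /andP[/forallP/(_ x)/eqP] := xchooseP (ex_sum_perm b t). Qed.

Lemma sum_permr b t y : sum_perm b t (phi (inr y)) = phi (inr (t y)).
Proof. by have /andP[_ /forallP/(_ y)/eqP] := xchooseP (ex_sum_perm b t). Qed.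

Lemma sum_permP (p q : {perm T}) :
  (forall u, p (phi u) = q (phi u)) -> p = q.
Proof.
have [psi phiK psiK] := phi_bij.
by move=> e; apply/permP => x; rewrite -[x]psiK.
Qed.

Lemma sum_permM b1 t1 b2 t2 :
  (sum_perm b1 t1 * sum_perm b2 t2 = sum_perm (b1 * b2) (t1 * t2))%g.
Proof.
by apply: sum_permP => -[x|y]; rewrite permM ?sum_perml ?sum_permr permM.
Qed.

Lemma sum_perm_inj b1 t1 b2 t2 :
  sum_perm b1 t1 = sum_perm b2 t2 -> b1 = b2 /\ t1 = t2.
Proof.
have phi_inj := bij_inj phi_bij.
move=> e; split; apply/permP => x.
  by have := sum_perml b1 t1 x; rewrite e sum_perml => /phi_inj[].
by have := sum_permr b1 t1 x; rewrite e sum_permr => /phi_inj[].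
Qed.

Lemma sum_perm_surj (p : {perm T}) :
  (forall x, exists x', p (phi (inl x)) = phi (inl x')) ->
  (forall y, exists y', p (phi (inr y)) = phi (inr y')) ->
  exists b t, p = sum_perm b t.
Proof.
have phi_inj := bij_inj phi_bij.
move=> /fin_all_exists[f fE] /fin_all_exists[g gE].
have f_inj : injective f.
  move=> x x' e; have : p (phi (inl x)) = p (phi (inl x')) by rewrite !fE e.
  by move=> /perm_inj/phi_inj[].
have g_inj : injective g.
  move=> y y' e; have : p (phi (inr y)) = p (phi (inr y')) by rewrite !gE e.
  by move=> /perm_inj/phi_inj[].
exists (perm f_inj), (perm g_inj).
by apply: sum_permP => -[x|y]; rewrite ?sum_perml ?sum_permr permE.
Qed.

End SumPerm.

(** Naming the position [j] after the descent avoids the wrap-around of [ordS], and the additive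
    form of the size avoids truncated subtraction. *)
Definition unique_descent_at n k (s : 'S_n) (i j : 'I_n) : Prop :=
  [/\ j = i.+1 :> nat, s j < s i, s i = s j + k :> nat &
      forall x y : 'I_n, y = x.+1 :> nat -> x != i -> s x < s y].

Lemma unique_descentP n k (s : 'S_n) :
  reflect (exists i j, unique_descent_at k s i j) (unique_descent_of_size k s).
Proof.
have ordSE (x y : 'I_n) : y = x.+1 :> nat -> ordS x = y.
  by move=> xy; apply: val_inj; rewrite /= -xy modn_small.
apply: (iffP existsP) => [[i /andP[/eqP dE /eqP sz]]|[i [j [ij lt sz asc]]]].
  have : i \in descents s by rewrite dE set11.
  rewrite inE => /andP[lt_in lt_s].
  exists i, (ordS i); split=> //.
  - by rewrite /= modn_small.
  - by move: sz; rewrite /descent_size; lia.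
  - move=> x y xy xi; have : x \notin descents s by rewrite dE inE.
    rewrite inE (ordSE _ _ xy) -xy ltn_ord /= -leqNgt leq_eqVlt => /orP[/eqP e|//].
    by have /perm_inj e' := val_inj e; move: xy; rewrite e'; lia.
exists i; rewrite /descent_size (ordSE _ _ ij); apply/andP; split; last by lia.
apply/eqP/setP => x; rewrite !inE; apply/andP/eqP => [[lt_xn lt_sx]|->].
  apply/eqP/negPn/negP => xi.
  have := asc x (Ordinal lt_xn) erefl xi.
  by move: lt_sx; rewrite (ordSE x (Ordinal lt_xn) erefl); lia.
by rewrite -ij ltn_ord (ordSE _ _ ij).
Qed.

(** * Fixed and moved points of a permutation with a single descent *)

Section UniqueDescent.

Variables (n k : nat) (s : 'S_n) (i j : 'I_n).
Hypothesis sP : unique_descent_at k s i j.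

(** The second condition puts [x] and [y] in the same increasing run, where each step raises the
    integer value by at least one. *)
Lemma run_gap (x y : 'I_n) : x <= y -> ~~ (x <= i < y) -> s x + (y - x) <= s y.
Proof.
have [ij _ _ asc] := sP.
move def_d: (y - x) => d.
elim: d y def_d => [|d IHd] y def_d le_xy Nxiy.
  by have -> : y = x by [apply: val_inj => /=; lia]; lia.
have lt_zn : y.-1 < n by have := ltn_ord y; lia.
pose z := Ordinal lt_zn.
have zi : z != i by apply/eqP => e; move: Nxiy; rewrite -e /=; lia.
have := asc z y; have := IHd z; rewrite /= => /(_ _ _ _) h1 /(_ _ zi) h2.
have := h2 ltac:(lia); have := h1 ltac:(lia) ltac:(lia) ltac:(lia); lia.
Qed.

Lemma first_run_ge (x : 'I_n) : x <= i -> x <= s x.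
Proof.
move=> xi; have lt0 : 0 < n by have := ltn_ord x; lia.
have := @run_gap (Ordinal lt0) x; rewrite /=; lia.
Qed.

Lemma second_run_le (x : 'I_n) : i < x -> s x <= x.
Proof.
move=> ix; have ltn1 : n.-1 < n by have := ltn_ord x; lia.
have := @run_gap x (Ordinal ltn1); rewrite /=.
have := ltn_ord (s (Ordinal ltn1)); have := ltn_ord x; lia.
Qed.

(** Strong induction on [x]. The preimage [p] of [x] is in the first run, since values in the second
    are at least [s j]; hence [p <= x]. If [p < x], then [p] is fixed by induction, so
    [x = s p = p], a contradiction. *)
Lemma fixed_below (x : 'I_n) : x < s j -> s x = x.
Proof.
have [ij _ _ _] := sP.
have [v] := ubnP x; elim: v x => // v IHv x le_xv lt_xm.
pose p := (s^-1)%g x; have spE : s p = x by rewrite permKV.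
have pi : p <= i.
  by rewrite leqNgt; apply/negP => ip; have := @run_gap j p; rewrite spE; lia.
have := first_run_ge pi; rewrite spE leq_eqVlt => /orP[/eqP e|lt_px].
  by rewrite -{1}(val_inj e).
have := IHv p ltac:(lia) ltac:(lia).
by rewrite spE => e; move: lt_px; rewrite e ltnn.
Qed.

Lemma fixed_above (x : 'I_n) : s i < x -> s x = x.
Proof.
have [ij _ _ _] := sP.
have [v] := ubnP (n - x); elim: v x => // v IHv x le_xv lt_Mx.
pose p := (s^-1)%g x; have spE : s p = x by rewrite permKV.
have pi : i < p.
  by rewrite ltnNge; apply/negP => ip; have := @run_gap p i; rewrite spE; lia.
have := second_run_le pi; rewrite spE leq_eqVlt => /orP[/eqP e|lt_px].
  by rewrite {1}(val_inj e).
have := ltn_ord p; have := IHv p => h1 h2.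
have := h1 ltac:(lia) ltac:(lia).
by rewrite spE => e; move: lt_px; rewrite e ltnn.
Qed.

(** A fixed point in the first run squeezes [s j] into being fixed too: [run_gap] bounds its image
    above and [first_run_ge] below. Injectivity then gives [s j = j], but [j] lies beyond the first
    run. The second run is symmetric, with [s i]. *)
Lemma moved_window (x : 'I_n) : s j <= x <= s i -> s x != x.
Proof.
have [ij lt_s _ _] := sP.
move=> /andP[mx xM]; apply/eqP => sx.
case: (leqP x i) => xi.
  have e : s (s j) = s j.
    apply: val_inj => /=.
    have := @run_gap (s j) x; have := @first_run_ge (s j); rewrite sx; lia.
  by move/perm_inj: e => e; move: mx; rewrite e; lia.
have e : s (s i) = s i.
  apply: val_inj => /=.
  have := @run_gap x (s i); have := @second_run_le (s i); rewrite sx; lia.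
by move/perm_inj: e => e; move: xM; rewrite e; lia.
Qed.

Lemma movedE (x : 'I_n) : (s x != x) = (s j <= x <= s i).
Proof.
apply/idP/idP => [|/moved_window//]; apply: contraR.
rewrite negb_and -!ltnNge => /orP[/fixed_below|/fixed_above] -> //.
Qed.

End UniqueDescent.

(** * Gluing a permutation of a window to one of the remaining points *)

Section Window.

Variables k r : nat.

Section FixedWindow.

Variable m : 'I_r.+1.

(** A window of [k.+1] points among [k.+1 + r] can start at [r.+1] places, hence the type of [m].
    The right summand lists the points outside it in increasing order. *)
Lemma window_pos_subproof (u : 'I_k.+1 + 'I_r) :
  match u with inl a => m + a | inr b => if b < m then nat_of_ord b else b + k.+1 end
    < k.+1 + r.
Proof.
have := ltn_ord m; case: u => [a|b]; first by have := ltn_ord a; lia.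
by have := ltn_ord b; case: ifP; lia.
Qed.

Definition window_pos (u : 'I_k.+1 + 'I_r) : 'I_(k.+1 + r) :=
  Ordinal (window_pos_subproof u).

Lemma window_pos_bij : bijective window_pos.
Proof.
apply: inj_card_bij; last by rewrite card_sum !card_ord.
move=> [a|b] [a'|b'] /(congr1 val) /= e.
- by congr inl; apply: val_inj; move: e => /=; lia.
- by move: e; have := ltn_ord a; case: ifP; lia.
- by move: e; have := ltn_ord a'; case: ifP; lia.
- by congr inr; apply: val_inj; move: e => /=; case: ifP; case: ifP; lia.
Qed.

Lemma window_posP (x : 'I_(k.+1 + r)) :
  if m <= x <= m + k then exists a : 'I_k.+1, x = window_pos (inl a)
  else exists b : 'I_r, x = window_pos (inr b).
Proof.
have [psi _ psiK] := window_pos_bij; rewrite -[x]psiK.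
case: (psi x) => [a|b].
  by rewrite ifT; [exists a | have := ltn_ord a; rewrite /=; lia].
by rewrite ifF; [exists b | rewrite /=; case: ifP; lia].
Qed.

Lemma window_descent (al : 'S_k.+1) (s : 'S_(k.+1 + r)) :
  s = sum_perm window_pos_bij al 1%g -> al \in calA k ->
  exists i j, unique_descent_at k s i j /\ s j = m :> nat.
Proof.
move=> sE; rewrite inE => /unique_descentP[i [j [ij lt_s sz asc]]].
have sl a : s (window_pos (inl a)) = m + al a :> nat by rewrite sE sum_perml.
have sr b : s (window_pos (inr b)) = window_pos (inr b).
  by rewrite sE sum_permr perm1.
(* Values of [al] lie between 0 and [k], so a drop of [k] must go from one extreme to the other. *)
have [si sj] : al i = k :> nat /\ al j = 0 :> nat.
  by have := ltn_ord (al i); lia.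
exists (window_pos (inl i)), (window_pos (inl j)).
split; last by rewrite sl sj addn0.
split; rewrite ?sl /=; try lia.
move=> x y xy xi.
have := window_posP x; have := window_posP y.
case: ifP => wy; case: ifP => wx [y' yE] [x' xE]; move: xy xi wx wy.
- rewrite xE yE !sl ltn_add2l => /= xy xi _ _.
  apply: asc; first lia.
  by apply: contraNneq xi => ->.
- by rewrite xE yE sl sr => xy _; have := ltn_ord y'; move: xy => /=; lia.
- rewrite xE yE sl sr => xy _; have := ltn_ord x'; have := ltn_ord (al x').
  by move: xy => /=; lia.
- by rewrite xE yE !sr => -> _ _ _.
Qed.

Lemma window_root (p : 'S_(k.+1 + r)) i j :
  unique_descent_at k (p ^+ 2)%g i j -> (p ^+ 2)%g j = m :> nat ->
  exists b t, [/\ b \in calB k, (t ^+ 2 == 1)%g & p = sum_perm window_pos_bij b t].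
Proof.
set s := (p ^+ 2)%g => sP sj; have [ij lt_s sz asc] := sP.
have inW x : (s x != x) = (m <= x <= m + k) by rewrite (movedE sP) sz sj.
have pW x : (m <= p x <= m + k) = (m <= x <= m + k).
  rewrite -!inW; have -> : s (p x) = p (s x) by rewrite /s !permM.
  by rewrite (inj_eq perm_inj).
have inl_W a : m <= window_pos (inl a) <= m + k by have := ltn_ord a; rewrite /=; lia.
have inr_W b : (m <= window_pos (inr b) <= m + k) = false by rewrite /=; case: ifP; lia.
have [a|b'|b [t pE]] := @sum_perm_surj _ _ _ _ window_pos_bij p.
- by have := window_posP (p (window_pos (inl a))); rewrite pW inl_W.
- by have := window_posP (p (window_pos (inr b'))); rewrite pW inr_W.
exists b, t; have sE : s = sum_perm window_pos_bij (b ^+ 2)%g (t ^+ 2)%g.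
  by rewrite /s pE !expgS !expg0 !mulg1 sum_permM.
split=> //; last first.
  apply/eqP/permP => y; rewrite perm1.
  have := inW (window_pos (inr y)).
  rewrite inr_W sE sum_permr => /negbFE/eqP.
  by move/(bij_inj window_pos_bij) => [].
have sl a : s (window_pos (inl a)) = m + (b ^+ 2)%g a :> nat by rewrite sE sum_perml.
(* The values [s i] and [s j] are the ends of the window, which [s] preserves, so the positions [i]
   and [j] lie in it as well. *)
have sW x : (m <= s x <= m + k) = (m <= x <= m + k).
  by rewrite -!inW (inj_eq perm_inj).
have [iW jW] : m <= i <= m + k /\ m <= j <= m + k by rewrite -(sW i) -(sW j) sz sj; lia.
have := window_posP i; rewrite iW => -[i' iE].
have := window_posP j; rewrite jW => -[j' jE].
rewrite !inE; apply/unique_descentP; exists i', j'; split.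
- by move: ij; rewrite iE jE /=; lia.
- by move: lt_s; rewrite iE jE !sl ltn_add2l.
- by move: sz; rewrite iE jE !sl -addnA => /addnI.
- move=> x y xy xi; have := asc (window_pos (inl x)) (window_pos (inl y)).
  rewrite !sl ltn_add2l; apply; first by rewrite /=; lia.
  by rewrite iE (inj_eq (bij_inj window_pos_bij)); apply: contraNneq xi => -[->].
Qed.

End FixedWindow.

Let glue (u : 'I_r.+1 * ('S_k.+1 * 'S_r)) : 'S_(k.+1 + r) :=
  sum_perm (window_pos_bij u.1) u.2.1 u.2.2.

Let data : {set 'I_r.+1 * ('S_k.+1 * 'S_r)} :=
  setX setT (setX (calB k) [set t : 'S_r | (t ^+ 2 == 1)%g]).

Lemma glue_descent u : u \in data ->
  exists i j, unique_descent_at k (glue u ^+ 2)%g i j /\ (glue u ^+ 2)%g j = u.1 :> nat.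
Proof.
case: u => m [b t]; rewrite !inE /= => /andP[bB /eqP tI].
apply: (window_descent (al := (b ^+ 2)%g)); last by rewrite inE.
by rewrite -tI /glue /= !expgS !expg0 !mulg1 sum_permM.
Qed.

(** The square determines its moved points, hence the window. The least point of the window of [v]
    is moved, so it lies in that of [u]; exchanging the roles gives equal starts. *)
Lemma glue_inj : {in data &, injective glue}.
Proof.
have le_window u v : u \in data -> v \in data -> glue u = glue v -> u.1 <= v.1.
  move=> /glue_descent[i [j [uP uj]]] /glue_descent[i' [j' [vP vj]]] e.
  have := movedE uP ((glue v ^+ 2)%g j'); rewrite {1}e (movedE vP) leqnn uj vj.
  by case: vP => _ lt_s _ _; lia.
move=> u v uD vD e.
have e1 : u.1 = v.1.
  by apply: val_inj; apply/eqP; rewrite eqn_leq (le_window u v) // (le_window v u).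
case: u v e1 e {uD vD} => m [b t] [m' [b' t']] /= <-.
by rewrite /glue /= => /sum_perm_inj[-> ->].
Qed.

Lemma card_sqrt_unique_descent :
  #|[set p : 'S_(k.+1 + r) | unique_descent_of_size k (p ^+ 2)%g]|
    = r.+1 * b_ k * e_ r.
Proof.
have -> : r.+1 * b_ k * e_ r = #|data| by rewrite !cardsX cardsT card_ord mulnA.
rewrite -(card_in_imset glue_inj); apply: eq_card => p; rewrite inE.
apply/unique_descentP/imsetP => [[i [j pP]]|[u uD ->]]; last first.
  by have [i [j [uP _]]] := glue_descent uD; exists i, j.
(* The window must fit: its top value, [k] above its start, is below [k.+1 + r]. *)
have lt_m : (p ^+ 2)%g j < r.+1.
  by case: pP => _ _ sz _; have := ltn_ord ((p ^+ 2)%g i); lia.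
have [b [t [bB tI pE]]] := window_root (m := Ordinal lt_m) pP erefl.
by exists (Ordinal lt_m, (b, t)); rewrite // !in_setX in_setT bB inE.
Qed.

End Window.

Theorem theorem4p7 (n k : nat) (hn : 3 <= n) (hk2 : 2 <= k) (hkn : k <= n - 1) :
  #|[set pi : 'S_n | unique_descent_of_size k (pi ^+ 2)%g]|
    = (n - k) * b_ k * e_ (n - k - 1).
Proof.
(* Here [r] counts the points outside the window. *)
have [r ->] : exists r, n = k.+1 + r by exists (n - k.+1); lia.
have -> : k.+1 + r - k = r.+1 by lia.
by rewrite subSS subn0 card_sqrt_unique_descent.
Qed.
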